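(* Let $u\colon\mathbb{N}\to\mathbb{R}$ be a bounded nonnegative function. Then, for all $n\ge0$, $\mathrm{Dom}\,N_u$ is an invariant subspace of $\partial_n^*$, and moreover it holds on $\mathrm{Dom}\,N_u$ that $$N_u\partial_n^*=\partial_n^*N_u+u(n)\partial_n^* .$$
   Context: $\mathbb{N}$ is the set of nonnegative integers and $\Gamma$ the set of all finite subsets of $\mathbb{N}$; $\mathbf{1}_\sigma$ is the indicator function of $\sigma\in\Gamma$. $(\Omega,\mathscr{F},\mathbb{P})$ is a probability space and $Z=(Z_n)_{n\ge0}$ an independent sequence of random variables with $\mathbb{P}\{Z_n=\theta_n\}=p_n$, $\mathbb{P}\{Z_n=-1/\theta_n\}=q_n$, where $0<p_n<1$, $q_n=1-p_n$, $\theta_n=\sqrt{q_n/p_n}$, and $\mathscr{F}$ is the $\sigma$-field generated by $Z$. $\mathsf{L}^2(Z)=L^2(\Omega,\mathscr{F},\mathbb{P})$ (complex-valued), with inner product $\langle\xi,\eta\rangle=\mathbb{E}[\overline{\xi}\eta]$. Put $Z_\emptyset=1$ and $Z_\sigma=\prod_{i\in\sigma}Z_i$; $\{Z_\sigma\mid\sigma\in\Gamma\}$ is an orthonormal basis of $\mathsf{L}^2(Z)$ (the canonical ONB). For $k\in\mathbb{N}$, $\partial_k$ is the bounded operator on $\mathsf{L}^2(Z)$ with $\partial_kZ_\sigma=\mathbf{1}_\sigma(k)Z_{\sigma\setminus\{k\}}$, and its adjoint satisfies $\partial_k^*Z_\sigma=[1-\mathbf{1}_\sigma(k)]Z_{\sigma\cup\{k\}}$,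 for all $\sigma\in\Gamma$. For bounded nonnegative $u\colon\mathbb{N}\to\mathbb{R}$, the 1D-weighted number operator $N_u$ associated with $u$ is $N_u\xi=\sum_{k=0}^\infty u(k)\partial_k^*\partial_k\xi$, with domain $\mathrm{Dom}\,N_u$ the set of all $\xi\in\mathsf{L}^2(Z)$ for which this series converges in $\mathsf{L}^2(Z)$. *)

(* Defs.v *)
From HB Require Import structures.
From mathcomp Require Import all_boot all_order all_algebra finmap.
From mathcomp Require Import generic_quotient ring_quotient.
From mathcomp Require Import all_classical all_reals all_analysis.
From mathcomp Require Import measurable_realfun.
From mathcomp Require Import complex.
From mathcomp Require Import ring lra.

Set Implicit Arguments.
Unset Strict Implicit.
Unset Printing Implicit Defensive.
Import Order.TTheory GRing.Theory Num.Theory.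
Import numFieldNormedType.Exports.
Local Open Scope classical_set_scope.
Local Open Scope ring_scope.
Local Open Scope quotient_scope.

(* Complex-valued L^2: the library has no measurable structure on R[i] and its
   L^p spaces are real-valued, so f : T -> R[i] is measurable and square
   integrable when its real and imaginary parts are. *)
Section L2fun.
Context d (T : measurableType d) (R : realType).
Variable mu : {measure set T -> \bar R}.
Local Notation Lfun2 := (Lfun mu 2%:E).

Definition L2fun_pred : {pred T -> R[i]} :=
  [pred f : T -> R[i] | (@complex.Re R \o f \in Lfun2)
                     && (@complex.Im R \o f \in Lfun2)].

Lemma L2fun_submod_closed : submod_closed L2fun_pred.
Proof.
have p1 : (1 <= 2%:E :> \bar R)%E by rewrite lee1n.
have := @Lfun_submod_closed _ T R mu _ p1; set S := Lfun _ _ => -[L0 LL].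
have LZ (a : R) f : f \in S -> (fun x => a * f x) \in S.
  by move=> fS; have := LL a f 0 fS L0; rewrite addr0.
have LD f g : f \in S -> g \in S -> (fun x => f x + g x) \in S.
  by move=> fS gS; have := LL 1 f g fS gS; rewrite scale1r.
split; first by rewrite inE; apply/andP; split; exact: L0.
move=> [a b] f g /andP[Rf If] /andP[Rg Ig]; rewrite inE; apply/andP; split.
- have -> : (@complex.Re R) \o ((a +i* b)%C *: f + g) =
      (fun x => (a * complex.Re (f x) + (- b) * complex.Im (f x))
                + complex.Re (g x)).
    apply/funext => x /=; rewrite !fctE.
    by case: (f x) => ? ?; case: (g x) => ? ? /=; rewrite mulNr.
  by apply: (LD) => //; apply: (LD); exact: LZ.
- have -> : (@complex.Im R) \o ((a +i* b)%C *: f + g) =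
      (fun x => (a * complex.Im (f x) + b * complex.Re (f x))
                + complex.Im (g x)).
    apply/funext => x /=; rewrite !fctE.
    by case: (f x) => ? ?; case: (g x) => ? ? /=.
  by apply: (LD) => //; apply: (LD); exact: LZ.
Qed.

HB.instance Definition _ :=
  GRing.isSubmodClosed.Build _ _ L2fun_pred L2fun_submod_closed.

Record L2fun := MkL2fun { L2fun_val :> T -> R[i]; _ : L2fun_val \in L2fun_pred }.
HB.instance Definition _ := [isSub of L2fun for L2fun_val].
HB.instance Definition _ := [Choice of L2fun by <:].
HB.instance Definition _ := [SubChoice_isSubZmodule of L2fun by <:].

Lemma L2fun_scale_subproof (a : R[i]) (f : L2fun) :
  (fun t => a * f t) \in L2fun_pred.
Proof.
have [_ /(_ a f 0 (valP f) (rpred0 _))] := L2fun_submod_closed.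
by rewrite addr0.
Qed.
Definition L2fun_scale a f := MkL2fun (L2fun_scale_subproof a f).

Definition L2null_pred : {pred L2fun} :=
  [pred f : L2fun | `[< {ae mu, forall x, f x = 0} >] ].

Lemma L2null_zmod_closed : zmod_closed L2null_pred.
Proof.
split; first by apply/asboolP; apply: aeW => x.
move=> f g /asboolP f0 /asboolP g0; apply/asboolP.
by move: f0 g0; apply: filterS2 => x /= fx gx; rewrite !fctE fx gx subr0.
Qed.

HB.instance Definition _ :=
  GRing.isZmodClosed.Build _ L2null_pred L2null_zmod_closed.

(* functions are identified when they are equal mu-almost everywhere *)
Definition L2 : Type := Quotient.quot L2null_pred.
HB.instance Definition _ := GRing.Zmodule.on L2.
HB.instance Definition _ := EqQuotient.on L2.

Implicit Types (f g : L2fun) (x y z : L2) (a b : R[i]).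

Lemma L2_eqP f g :
  reflect ({ae mu, forall t, f t = g t}) (\pi_L2 f == \pi_L2 g).
Proof.
rewrite -[_ == _]/(f == g %[mod Quotient.quot L2null_pred]) -Quotient.idealrBE.
apply: (iffP (asboolP _)); apply: filterS => t /=.
  by rewrite !fctE => /eqP; rewrite subr_eq0 => /eqP.
by rewrite !fctE => ->; rewrite subrr.
Qed.

Lemma L2_piD f g : \pi_L2 (f + g) = \pi_L2 f + \pi_L2 g.
Proof. exact: (@Quotient.pi_add _ _ f g). Qed.

Lemma L2_pi0 : \pi_L2 0 = 0.
Proof. by apply: (addrI (\pi_L2 0)); rewrite -(L2_piD 0 0) !addr0. Qed.

Definition L2_scale a x : L2 := \pi_L2 (L2fun_scale a (repr x)).

Lemma L2_piZ a f : \pi_L2 (L2fun_scale a f) = L2_scale a (\pi_L2 f).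
Proof.
apply/eqP/L2_eqP.
have /eqP/L2_eqP : \pi_L2 f = \pi_L2 (repr (\pi_L2 f)) by rewrite reprK.
by apply: filterS => t /= ->.
Qed.

Lemma L2_eq f g : (forall t, f t = g t) -> \pi_L2 f = \pi_L2 g.
Proof. by move=> fg; apply/eqP/L2_eqP/aeW. Qed.

Lemma L2_piP x : exists f, x = \pi_L2 f.
Proof. by exists (repr x); rewrite reprK. Qed.

Fact L2_scaleA a b x : L2_scale a (L2_scale b x) = L2_scale (a * b) x.
Proof.
have [f ->] := L2_piP x; rewrite -(L2_piZ b f) -!L2_piZ.
by apply: L2_eq => t /=; rewrite mulrA.
Qed.
Fact L2_scale1 : left_id 1 L2_scale.
Proof.
move=> x; have [f ->] := L2_piP x; rewrite -L2_piZ.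
by apply: L2_eq => t /=; rewrite mul1r.
Qed.
Fact L2_scaleDr : right_distributive L2_scale +%R.
Proof.
move=> a x y; have [f ->] := L2_piP x; have [g ->] := L2_piP y.
rewrite -(L2_piZ a f) -(L2_piZ a g) -!L2_piD -L2_piZ.
by apply: L2_eq => t /=; rewrite !fctE mulrDr.
Qed.
Fact L2_scaleDl x : {morph L2_scale^~ x : a b / a + b}.
Proof.
move=> a b; have [f ->] := L2_piP x.
rewrite -(L2_piZ a f) -(L2_piZ b f) -L2_piD -L2_piZ.
by apply: L2_eq => t /=; rewrite !fctE mulrDl.
Qed.

HB.instance Definition _ := GRing.Zmodule_isLmodule.Build R[i] L2
  L2_scaleA L2_scale1 L2_scaleDr L2_scaleDl.

Definition cintegral (h : T -> R[i]) : R[i] :=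
  ((\int[mu]_t complex.Re (h t))%R +i* (\int[mu]_t complex.Im (h t))%R)%C.

(* conjugate-linear in the first argument *)
Definition inner x y : R[i] := cintegral (fun t => (repr x t)^*%C * repr y t).

(* sqrt <x, x>, R[i]-valued as required by normedModType R[i] *)
Definition normL2 x : R[i] := (Num.sqrt (complex.Re (inner x x)))%:C%C.

Let C_ f g := fun t => complex.Re ((f t)^*%C * g t).

Let C_E f g : C_ f g = ((@complex.Re R \o f) \* (@complex.Re R \o g)) \+
                     ((@complex.Im R \o f) \* (@complex.Im R \o g)).
Proof.
apply/funext => t; rewrite /C_ /=.
by case: (f t) (g t) => ? ? [? ?] /=; rewrite mulNr opprK.
Qed.

Let C_int f g : mu.-integrable setT (EFin \o C_ f g).
Proof.
have /andP[Rf If] := valP f; have /andP[Rg Ig] := valP g.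
have intD (h k : T -> R) : mu.-integrable setT (EFin \o h) ->
    mu.-integrable setT (EFin \o k) -> mu.-integrable setT (EFin \o (h \+ k)).
  by move=> hi ki; exact: (integrableD measurableT hi ki).
by rewrite C_E; apply: intD; apply/Lfun1_integrable; exact: Lfun2_mul_Lfun1.
Qed.

Let B x y := complex.Re (inner x y).

Let B_pi f g : B (\pi_L2 f) (\pi_L2 g) = Rintegral mu setT (C_ f g).
Proof.
rewrite /B /= -/(C_ (repr (\pi_L2 f)) (repr (\pi_L2 g))).
have mC f' g' := measurable_int _ (C_int f' g').
congr fine; apply: ae_eq_integral => //; [exact: mC|exact: mC|].
have /eqP/L2_eqP : \pi_L2 f = \pi_L2 (repr (\pi_L2 f)) by rewrite reprK.
have /eqP/L2_eqP : \pi_L2 g = \pi_L2 (repr (\pi_L2 g)) by rewrite reprK.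
by apply: filterS2 => t gt ft _; rewrite /= /C_ gt ft.
Qed.

Let BC x y : B x y = B y x.
Proof.
have [f ->] := L2_piP x; have [g ->] := L2_piP y; rewrite !B_pi.
by apply: eq_Rintegral => t _; rewrite -!/(C_ _ _ t) !C_E /=; congr (_ + _);
  exact: mulrC.
Qed.

Let BDr x y z : B x (y + z) = B x y + B x z.
Proof.
have [f ->] := L2_piP x; have [g ->] := L2_piP y; have [h ->] := L2_piP z.
rewrite -(L2_piD g h) !B_pi -(RintegralD measurableT (C_int f g) (C_int f h)).
apply: eq_Rintegral => t _.
rewrite /C_ [(g + h) t](_ : _ = g t + h t)// mulrDr.
by case: (_ * _) (_ * _) => ? ? [].
Qed.

Let BZr (r : R) x y : B x (r%:C%C *: y) = r * B x y.
Proof.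
have [f ->] := L2_piP x; have [g ->] := L2_piP y.
rewrite [_ *: _](esym (L2_piZ _ g)) !B_pi -(RintegralZl _ measurableT (C_int f g)).
apply: eq_Rintegral => t _; rewrite /C_ /= mulrCA.
by case: (_ * g t) => ? ? /=; rewrite mul0r subr0.
Qed.

Let BDl x y z : B (x + y) z = B x z + B y z.
Proof. by rewrite BC BDr !(BC z). Qed.
Let BZl (r : R) x y : B (r%:C%C *: x) y = r * B x y.
Proof. by rewrite BC BZr BC. Qed.

Let C_ge0 f t : 0 <= C_ f f t.
Proof. by rewrite C_E /= addr_ge0// -expr2 sqr_ge0. Qed.

Let B_ge0 x : 0 <= B x x.
Proof.
have [f ->] := L2_piP x; rewrite B_pi.
by apply: Rintegral_ge0 => t _; exact: C_ge0.
Qed.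

Let B_eq0 x : B x x = 0 -> x = 0.
Proof.
have [f ->] := L2_piP x; rewrite B_pi => Bx0.
have mC := measurable_int _ (C_int f f).
suff /(ae_eq_integral_abs mu measurableT mC) : (\int[mu]_t `|(EFin \o C_ f f) t| = 0)%E.
  move=> f0; rewrite -L2_pi0; apply/eqP.
  apply/L2_eqP; apply: filterS f0 => t /= /(_ I)[].
  rewrite C_E /= => /eqP; rewrite paddr_eq0 -?expr2 ?sqr_ge0// !sqrf_eq0.
  by case: (f t) => ? ? /= /andP[/eqP-> /eqP->].
rewrite (_ : (\int[mu]_t _ = \int[mu]_t (C_ f f t)%:E)%E).
  by rewrite -[LHS]fineK ?(integrable_fin_num measurableT (C_int f f))//; congr _%:E.
by apply: eq_integral => t _; rewrite /= ger0_norm.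
Qed.

Let CauchySchwarz x y : B x y <= Num.sqrt (B x x) * Num.sqrt (B y y).
Proof.
have [y0|yN0] := eqVneq (B y y) 0.
  rewrite (B_eq0 y0) -(scale0r 0) (BZr 0) mul0r mulr_ge0 ?sqrtr_ge0//.
have y_gt0 : 0 < B y y by rewrite lt_def yN0 B_ge0.
rewrite -sqrtrM// (le_trans (ler_norm _))// -sqrtr_sqr ler_wsqrtr//.
have := B_ge0 ((B y y)%:C%C *: x + (- B x y)%:C%C *: y).
rewrite BDl !BDr !BZl !BZr (BC y x).
rewrite (_ : _ + _ = B y y * (B x x * B y y - B x y ^+ 2)); last by ring.
by rewrite pmulr_rge0// subr_ge0.
Qed.

Fact normL2D x y : normL2 (x + y) <= normL2 x + normL2 y.
Proof.
rewrite /normL2 -rmorphD lecR -[leRHS]ger0_norm ?addr_ge0 ?sqrtr_ge0//.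
rewrite -sqrtr_sqr ler_wsqrtr// sqrrD !sqr_sqrtr ?B_ge0// -!/(B _ _).
have := CauchySchwarz x y.
rewrite BDl !BDr (BC y x) => h; lra.
Qed.

Fact normL2Z a x : normL2 (a *: x) = `|a| * normL2 x.
Proof.
have -> : `|a| = (Num.sqrt (complex.Re a ^+ 2 + complex.Im a ^+ 2))%:C%C.
  by case: a.
rewrite /normL2 -rmorphM -sqrtrM ?addr_ge0 ?sqr_ge0//; congr (Num.sqrt _)%:C%C.
rewrite -!/(B _ _); have [f ->] := L2_piP x.
rewrite [_ *: _](esym (L2_piZ _ f)) !B_pi -(RintegralZl _ measurableT (C_int f f)).
apply: eq_Rintegral => t _; rewrite /C_ /=; case: a (f t) => [p q] [v w] /=; ring.
Qed.

Fact normL2_eq0 x : normL2 x = 0 -> x = 0.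
Proof.
case=> /eqP; rewrite sqrtr_eq0 => Bx; apply/B_eq0/eqP.
by rewrite eq_le Bx B_ge0.
Qed.

HB.instance Definition _ :=
  Lmodule_isNormed.Build R[i] L2 normL2D normL2Z normL2_eq0.

End L2fun.

Section bernoulli_noise.
Context d (Omega : measurableType d) (R : realType) (P : probability Omega R).
Implicit Types (p : nat -> R) (Z : nat -> {RV P >-> R}).

Definition theta p n : R := Num.sqrt ((1 - p n) / p n).

Definition mutually_independent Z := forall (s : {fset nat}) (B : nat -> set R),
  (forall i, measurable (B i)) ->
  P (\bigcap_(i in [set` s]) (Z i @^-1` B i)) =
    (\prod_(i <- s) P (Z i @^-1` B i))%E.

(* noise_gen: the sigma-field of Omega is exactly the one generated by Z *)
Record bernoulli_noise p Z : Prop := BernoulliNoise {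
  noise_prob : forall n, 0 < p n < 1;
  noise_indep : mutually_independent Z;
  noise_pos : forall n, P (Z n @^-1` [set theta p n]) = (p n)%:E;
  noise_neg : forall n, P (Z n @^-1` [set - (theta p n)^-1]) = (1 - p n)%:E;
  noise_gen : @measurable _ Omega =
    <<s \bigcup_n preimage_set_system setT (Z n) measurable >> }.

Definition Zprod Z (s : {fset nat}) (w : Omega) : R := \prod_(i <- s) Z i w.

Lemma Zprod_L2 p Z (hZ : bernoulli_noise p Z) (s : {fset nat}) :
  (fun w => (Zprod Z s w)%:C%C) \in L2fun_pred P.
Proof.
pose M n : R := Num.max (theta p n) (theta p n)^-1.
have M0 n : 0 <= M n by rewrite le_max sqrtr_ge0.
have mZ n (r : R) : measurable (Z n @^-1` [set r]).
  by rewrite -[X in measurable X]setTI; exact: measurable_funP.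
have Zbd n : {ae P, forall w, `|Z n w| <= M n}.
  have /andP[p0 p1] := noise_prob hZ n.
  have th0 : 0 < theta p n by rewrite sqrtr_gt0 divr_gt0// subr_gt0.
  pose A := Z n @^-1` [set theta p n] `|` Z n @^-1` [set - (theta p n)^-1].
  have mA : measurable A by exact: measurableU.
  have PA : P A = 1%E.
    transitivity (P (Z n @^-1` [set theta p n]) +
                  P (Z n @^-1` [set (- (theta p n)^-1)%R]))%E.
      apply: measureU => //; apply/seteqP; split => // w [/= -> E].
      by have := th0; rewrite {1}E oppr_gt0 invr_lt0 ltNge ltW.
    by rewrite (noise_pos hZ) (noise_neg hZ) -EFinD (addrC (p n)) subrK.
  exists (~` A); split; first exact: measurableC.
    by rewrite probability_setC// PA subee.
  apply: subsetC => w [] /= ->.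
    by rewrite gtr0_norm// le_max lexx.
  by rewrite normrN gtr0_norm ?invr_gt0// le_max lexx orbT.
have Zrbd (r : seq nat) :
    {ae P, forall w, `|\prod_(i <- r) Z i w| <= \prod_(i <- r) M i}.
  elim: r => [|i r IH]; first by apply: aeW => w; rewrite !big_nil normr1.
  by apply: filterS2 (Zbd i) IH => w h1 h2; rewrite !big_cons normrM ler_pM.
have Zsbd : {ae P, forall w, `|Zprod Z s w| <= \prod_(i <- s) M i} := Zrbd s.
have mZs : measurable_fun setT (Zprod Z s) by exact: measurable_prod.
rewrite inE; apply/andP; split; last exact: (Lfun_cst P 0).
rewrite inE /=; apply/andP; split; rewrite inE//= /finite_norm unlock poweR_lty//.
set K := \prod_(i <- s) M i in Zsbd.
have K0 : 0 <= K by exact: prodr_ge0.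
rewrite (@le_lt_trans _ _ (\int[P]_w (cst (K `^ 2)%:E w))%E)//; last first.
  by rewrite integral_cst// [X in (_ * X)%E](probability_setT P) mule1 ltry.
apply: ae_ge0_le_integral => //.
- by move=> w _; rewrite lee_fin powR_ge0.
- apply/measurable_EFinP.
  apply/(@measurableT_comp _ _ _ _ _ _ (fun x : R => x `^ 2)%R) => //.
  exact/measurableT_comp.
- by move=> w _; rewrite lee_fin powR_ge0.
- apply: filterS Zsbd => w h _; rewrite lee_fin.
  by rewrite ge0_ler_powR ?nnegrE.
Qed.

Definition Zbasis p Z (hZ : bernoulli_noise p Z) (s : {fset nat}) : L2 P :=
  \pi_(L2 P) (MkL2fun (Zprod_L2 hZ s)).

Definition bounded_op (A : L2 P -> L2 P) :=
  exists M : R, forall x, `|A x| <= M%:C%C * `|x|.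

(* The system (Zbasis hZ s)_s is total in L2 P, so these conditions determine A
   uniquely. *)
Definition annihilation p Z (hZ : bernoulli_noise p Z) (k : nat)
    (A : {linear L2 P -> L2 P}) :=
  bounded_op A /\
  forall s, A (Zbasis hZ s) = (k \in s)%:R *: Zbasis hZ (s `\ k)%fset.

Definition is_adjoint (A Astar : L2 P -> L2 P) :=
  forall x y, inner (Astar x) y = inner x (A y).

Section number_operator.
Variables (u : nat -> R) (del delA : nat -> L2 P -> L2 P).

Definition number_series (xi : L2 P) : nat -> L2 P :=
  series (fun k => (u k)%:C%C *: delA k (del k xi)).

Definition number_dom : set (L2 P) := [set xi | cvgn (number_series xi)].

Definition number_op (xi : L2 P) : L2 P := limn (number_series xi).

End number_operator.

Definition invariant_subspace (A : L2 P -> L2 P) (D : set (L2 P)) :=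
  [/\ D 0, forall (a : R[i]) x y, D x -> D y -> D (a *: x + y)
    & A @` D `<=` D].

End bernoulli_noise.

(* Main.v *)
(* The system (Z_s) is orthonormal, by independence and the first two moments of
   the noise, and total: on the two values of Z_n every function is affine, so
   the indicator of a cylinder is almost surely a combination of the Z_s, and
   the cylinders form a pi-system generating the sigma-field. Testing against
   the Z_s and moving all operators to the other side of the inner product
   gives, with D_k = del_k^* del_k,

     D_k del_n^* = del_n^* D_k + [k = n] del_n^*,

   so the partial sums of the series of N_u at del_n^* xi are the images by the
   continuous operator del_n^* of those at xi, plus u(n) del_n^* xi from rank
   n + 1 on. *)
Require Import Defs.
From mathcomp Require Import all_boot all_order all_algebra finmap.
From mathcomp Require Import all_classical all_reals all_analysis.
From mathcomp Require Import measurable_realfun complex ring lra.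
Set Implicit Arguments.
Unset Strict Implicit.
Unset Printing Implicit Defensive.
Import Order.TTheory GRing.Theory Num.Theory.
Import numFieldNormedType.Exports.
Local Open Scope classical_set_scope.
Local Open Scope ring_scope.
Local Open Scope quotient_scope.

(** * The complex inner product: sesquilinearity, Cauchy-Schwarz, adjoints *)

Section L2_inner.
Context d (T : measurableType d) (R : realType).
Context (mu : {measure set T -> \bar R}).
Implicit Types (f g : L2fun mu) (x y z : L2 mu) (h : T -> R[i]).

Definition cintegrable h :=
  mu.-integrable setT (EFin \o (@complex.Re R \o h)) /\
  mu.-integrable setT (EFin \o (@complex.Im R \o h)).

Lemma cintegrable_mul f g : cintegrable (fun t => (f t)^*%C * g t).
Proof.
have /andP[Rf If] := valP f; have /andP[Rg Ig] := valP g.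
split.
- apply: (eq_integrable measurableT (fun t => (complex.Re (f t) * complex.Re (g t))%:E
    + (complex.Im (f t) * complex.Im (g t))%:E)%E).
    move=> t _ /=; case: (f t) (g t) => ? ? [? ?] /=.
    by rewrite mulNr opprK.
  apply: integrableD => //.
    exact/Lfun1_integrable/(Lfun2_mul_Lfun1 Rf Rg).
  exact/Lfun1_integrable/(Lfun2_mul_Lfun1 If Ig).
- apply: (eq_integrable measurableT (fun t => (complex.Re (f t) * complex.Im (g t))%:E
    - (complex.Im (f t) * complex.Re (g t))%:E)%E).
    move=> t _ /=; case: (f t) (g t) => ? ? [? ?] /=.
    by rewrite mulNr.
  apply: integrableB => //.
    exact/Lfun1_integrable/(Lfun2_mul_Lfun1 Rf Ig).
  exact/Lfun1_integrable/(Lfun2_mul_Lfun1 If Rg).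
Qed.

(** [inner] is defined through chosen representatives. Since these agree almost everywhere with [f]
    and [g], the integrals coincide, and any representative may be used from here on. *)
Lemma inner_pi f g :
  inner (\pi_(L2 mu) f) (\pi_(L2 mu) g) =
  cintegral mu (fun t => (f t)^*%C * g t).
Proof.
have /eqP/L2_eqP ff : \pi_(L2 mu) f = \pi_(L2 mu) (repr (\pi_(L2 mu) f)).
  by rewrite reprK.
have /eqP/L2_eqP gg : \pi_(L2 mu) g = \pi_(L2 mu) (repr (\pi_(L2 mu) g)).
  by rewrite reprK.
set f' := repr _ in ff; set g' := repr _ in gg.
have [iR iI] := cintegrable_mul f g; have [iR' iI'] := cintegrable_mul f' g'.
rewrite /inner /cintegral; congr (_ +i* _)%C; congr fine;
  apply: ae_eq_integral => //; do ?[exact: measurable_int iR|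
    exact: measurable_int iR'|exact: measurable_int iI|
    exact: measurable_int iI'];
  by apply: filterS2 ff gg => t ft gt _ /=; rewrite ft gt.
Qed.

Lemma cintegralD h1 h2 : cintegrable h1 -> cintegrable h2 ->
  cintegral mu (fun t => h1 t + h2 t) = cintegral mu h1 + cintegral mu h2.
Proof.
move=> [R1 I1] [R2 I2]; apply/eqP; rewrite eq_complex /=.
rewrite -(RintegralD measurableT R1 R2) -(RintegralD measurableT I1 I2).
by apply/andP; split; apply/eqP/eq_Rintegral => t _ /=;
  case: (h1 t) (h2 t) => ? ? [].
Qed.

Lemma cintegralZ (a : R[i]) h : cintegrable h ->
  cintegral mu (fun t => a * h t) = a * cintegral mu h.
Proof.
move=> [Rh Ih]; case: a => a b; apply/eqP; rewrite eq_complex /=.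
have iZ (c : R) k : mu.-integrable setT (EFin \o k) ->
  mu.-integrable setT (EFin \o (fun t => c * k t)).
  by move=> ik; exact: (integrableZl measurableT c ik).
rewrite -!(RintegralZl _ measurableT)//.
rewrite -(RintegralB measurableT (iZ a _ Rh) (iZ b _ Ih)).
rewrite -(RintegralD measurableT (iZ a _ Ih) (iZ b _ Rh)).
by apply/andP; split; apply/eqP/eq_Rintegral => t _ /=; case: (h t).
Qed.

Lemma innerDr x y z : inner x (y + z) = inner x y + inner x z.
Proof.
have [f ->] := L2_piP x; have [g ->] := L2_piP y; have [k ->] := L2_piP z.
rewrite -(L2_piD g k) !inner_pi -cintegralD; [|exact: cintegrable_mul..].
congr cintegral; apply/funext => t.
by rewrite [(g + k) t](_ : _ = g t + k t)// mulrDr.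
Qed.

Lemma innerZr (a : R[i]) x y : inner x (a *: y) = a * inner x y.
Proof.
have [f ->] := L2_piP x; have [g ->] := L2_piP y.
rewrite [_ *: _](esym (L2_piZ _ g)) !inner_pi.
rewrite -cintegralZ; last exact: cintegrable_mul.
by congr cintegral; apply/funext => t /=; rewrite mulrCA.
Qed.

Lemma inner_conj x y : inner y x = (inner x y)^*%C.
Proof.
have [f ->] := L2_piP x; have [g ->] := L2_piP y.
rewrite !inner_pi; have [Rfg Ifg] := cintegrable_mul f g.
apply/eqP; rewrite eq_complex /=; apply/andP; split; apply/eqP.
  apply: eq_Rintegral => t _; case: (f t) (g t) => ? ? [? ?] /=; ring.
rewrite -mulN1r -(RintegralZl _ measurableT)//.
apply: eq_Rintegral => t _ /=; case: (f t) (g t) => ? ? [? ?] /=; ring.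
Qed.

Lemma inner0r x : inner x 0 = 0.
Proof. by rewrite -(scale0r (0 : L2 mu)) innerZr mul0r. Qed.

Lemma inner0l x : inner 0 x = 0.
Proof. by rewrite inner_conj inner0r conjc0. Qed.

Lemma innerBr x y z : inner x (y - z) = inner x y - inner x z.
Proof. by rewrite innerDr -scaleN1r innerZr mulN1r. Qed.

Lemma Re_inner_ge0 x : 0 <= complex.Re (inner x x).
Proof.
have [f ->] := L2_piP x; rewrite inner_pi /=.
apply: Rintegral_ge0 => t _; case: (f t) => a b /=.
by rewrite mulNr opprK addr_ge0// -expr2 sqr_ge0.
Qed.

Lemma normL2E x : `|x| = (Num.sqrt (complex.Re (inner x x)))%:C%C.
Proof. by []. Qed.

(* The norm already satisfies the triangle inequality, and squaring it gives the
   Cauchy-Schwarz inequality. *)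
Lemma Re_inner_le x y : complex.Re (inner x y) <=
  Num.sqrt (complex.Re (inner x x)) * Num.sqrt (complex.Re (inner y y)).
Proof.
have := ler_normD x y; rewrite !normL2E -rmorphD lecR.
rewrite -(ler_pXn2r (n := 2))// ?nnegrE ?addr_ge0 ?sqrtr_ge0//.
rewrite sqrrD !sqr_sqrtr ?Re_inner_ge0// innerDr.
rewrite (inner_conj x (x + y)) (inner_conj y (x + y)) !innerDr.
rewrite (inner_conj x y); case: (inner x x) (inner x y) (inner y y).
by move=> ? ? [? ?] [? ?] /=; lra.
Qed.

(** Conjugate symmetry transfers the adjoint relation to the other argument. *)
Lemma inner_adjr (A B : L2 mu -> L2 mu) :
  (forall x y, inner (B x) y = inner x (A y)) ->
  forall x y, inner x (B y) = inner (A x) y.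
Proof. by move=> AB x y; rewrite inner_conj AB -inner_conj. Qed.

End L2_inner.

(** Each bounded measurable factor preserves integrability. Keeping [h] apart covers both products
    of bounded factors alone and such products tested against an integrable function. *)
Lemma finite_integrable_prod d (T : measurableType d) (R : realType)
    (mu : {measure set T -> \bar R}) (I : Type) (F : I -> T -> R) (M : I -> R)
    (r : seq I) (h : T -> R) :
  (forall i, measurable_fun setT (F i)) -> (forall i t, `|F i t| <= M i) ->
  mu.-integrable setT (EFin \o h) ->
  mu.-integrable setT (EFin \o (fun t => (\prod_(i <- r) F i t) * h t)).
Proof.
move=> mF bF ih; elim: r => [|i r IH].
  by apply: eq_integrable ih => // t _ /=; rewrite big_nil mul1r.
apply: (eq_integrable measurableT _ _ _ (integrableMr measurableT (mF i) _ IH)).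
  by move=> t _ /=; rewrite big_cons -mulrA EFinM.
exists (M i); split; first exact: num_real.
by move=> x Mx t _ /=; exact: le_trans (bF i t) (ltW Mx).
Qed.

(** * Values of the noise and expectations of products under independence *)

Section noise.
Context d (Omega : measurableType d) (R : realType) (P : probability Omega R).
Context (p : nat -> R) (Z : nat -> {RV P >-> R}) (hZ : bernoulli_noise p Z).
Local Notation th := (theta p).

Lemma theta_gt0 n : 0 < th n.
Proof.
have /andP[p0 p1] := noise_prob hZ n.
by rewrite sqrtr_gt0 divr_gt0// subr_gt0.
Qed.

Lemma measurable_noise n (B : set R) : measurable B -> measurable (Z n @^-1` B).
Proof.
by move=> mB; rewrite -[X in measurable X]setTI; exact: measurable_funP.
Qed.

(** The two values have opposite signs, so their events are disjoint and the probabilities add up to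
    1; a countable union of null sets then handles all [n] at once. *)
Lemma noise_two_values :
  {ae P, forall w, forall n, Z n w = th n \/ Z n w = - (th n)^-1}.
Proof.
apply: ae_foralln => n.
pose A := Z n @^-1` [set th n] `|` Z n @^-1` [set - (th n)^-1].
have mA : measurable A by apply: measurableU; exact: measurable_noise.
have PA : P A = 1%E.
  transitivity (P (Z n @^-1` [set th n]) +
                P (Z n @^-1` [set (- (th n)^-1)%R]))%E.
    apply: measureU; [exact: measurable_noise..|].
    apply/seteqP; split => // w [/= -> E].
    by have := theta_gt0 n; rewrite {1}E oppr_gt0 invr_lt0 ltNge ltW// theta_gt0.
  by rewrite (noise_pos hZ) (noise_neg hZ) -EFinD (addrC (p n)) subrK.
exists (~` A); split; first exact: measurableC.
  by transitivity (1 - P A)%E; [exact: probability_setC|rewrite PA subee].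
by apply: subsetC => w [] /= ->; [left|right].
Qed.

Section independence.
Context (B : nat -> set R) (mB : forall i, measurable (B i)).
Let X i : Omega -> R := \1_(Z i @^-1` B i).

Let mX i : measurable_fun setT (X i).
Proof. by apply: measurable_indic; exact: measurable_noise. Qed.

Let bX i w : `|X i w| <= 1.
Proof. by rewrite /X indicE ger0_norm// lern1 leq_b1. Qed.

Lemma prod_indic_cylinder (t : seq nat) w :
  \prod_(i <- t) X i w = \1_(\bigcap_(i in [set` t]) (Z i @^-1` B i)) w.
Proof.
rewrite indicE; elim: t => [|i t IH].
  by rewrite big_nil mem_set// => i; rewrite /= in_nil.
rewrite big_cons IH {1}/X indicE -natrM mulnb; congr (_%:R : R); congr nat_of_bool.
apply/idP/idP => [/andP[/set_mem Bi /set_mem Bt]|/set_mem Bit].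
  apply/mem_set => j /=; rewrite inE => /predU1P[->//|jt].
  exact: Bt.
apply/andP; split; apply/mem_set; first by apply: Bit; rewrite /= mem_head.
by move=> j jt; apply: Bit; rewrite /= inE jt orbT.
Qed.

(* The induction on [s] uses linearity in one factor at a time, which turns the
   affine factor of index [i] into 1 or into the indicator [X i]. *)
Lemma expectation_prod_affine (a b : nat -> R) (s t : seq nat) :
  uniq (t ++ s) ->
  (\int[P]_w ((\prod_(i <- t) X i w) * \prod_(i <- s) (a i + b i * X i w)))%R =
  (\prod_(i <- t) fine (P (Z i @^-1` B i))) *
  \prod_(i <- s) (a i + b i * fine (P (Z i @^-1` B i))).
Proof.
elim: s t => [|i s IH] t.
  rewrite cats0 big_nil mulr1 => ut.
  under eq_Rintegral do rewrite big_nil mulr1 prod_indic_cylinder.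
  have mC : measurable (\bigcap_(i in [set` t]) (Z i @^-1` B i)).
    by apply: bigcap_measurableType => k _; exact: measurable_noise.
  rewrite /Rintegral integral_indic// setIT.
  (* Independence is stated over finite sets, so [t] is replaced by the set of its entries; as [t]
     has no duplicates, the product is unchanged. *)
  have <- : [set` [fset x in t]%fset] = [set` t].
    by apply/seteqP; split => x /=; rewrite in_fset.
  transitivity (fine (\prod_(i <- [fset x in t]%fset) P (Z i @^-1` B i))).
    by congr fine; exact: (noise_indep hZ).
  rewrite (perm_big t) /=; last first.
    by apply: uniq_perm => [|//|x]; [exact: fset_uniq|rewrite in_fset].
  rewrite -[RHS]/(fine (\prod_(i <- t) fine (P (Z i @^-1` B i)))%:E).
  congr fine; rewrite -prodEFin; apply: eq_bigr => k _.
  by rewrite fineK// fin_num_measure//; exact: measurable_noise.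
move=> us; have [u1 u2] : uniq (t ++ s) /\ uniq ((i :: t) ++ s).
  have : uniq ((i :: t) ++ s) by rewrite -[_ ++ _]/([:: i] ++ t ++ s) uniq_catCA.
  by move=> /[dup] /andP[_].
have I r : P.-integrable setT (EFin \o (fun w =>
    (\prod_(i <- r) X i w) * \prod_(i <- s) (a i + b i * X i w))).
  apply: (finite_integrable_prod (M := cst 1)) => //.
  apply: (eq_integrable measurableT _ _ _ (@finite_integrable_prod _ _ _ P nat
    (fun i w => a i + b i * X i w) (fun i => `|a i| + `|b i|) s (cst 1) _ _ _)).
  - by move=> w _ /=; rewrite mulr1.
  - by move=> k; apply: measurable_funD => //; apply: measurable_funM.
  - move=> k w; apply: le_trans (ler_normD _ _) _.
    by rewrite lerD2l normrM ler_piMr.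
  - exact: finite_measure_integrable_cst.
rewrite (@eq_Rintegral _ _ _ P _ (fun w =>
    a i * ((\prod_(j <- t) X j w) * \prod_(j <- s) (a j + b j * X j w)) +
    b i * ((\prod_(j <- i :: t) X j w) * \prod_(j <- s) (a j + b j * X j w))));
  last by move=> w _; rewrite !big_cons; ring.
have IZ c r : P.-integrable setT (EFin \o (fun w =>
    c * ((\prod_(i <- r) X i w) * \prod_(i <- s) (a i + b i * X i w)))).
  exact: (integrableZl measurableT c (I r)).
rewrite (RintegralD measurableT (IZ _ _) (IZ _ _)).
rewrite !(RintegralZl _ measurableT)// !IH// !big_cons; ring.
Qed.

End independence.

(** Almost surely each factor is affine in the indicator of [Z i = th i], which reduces the claim to
    the affine case. *)
Lemma expectation_prod_noise (phi : nat -> R -> R) (s : seq nat) : uniq s ->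
  (forall i, measurable_fun setT (phi i)) ->
  (\int[P]_w \prod_(i <- s) phi i (Z i w))%R =
  \prod_(i <- s) (p i * phi i (th i) + (1 - p i) * phi i (- (th i)^-1)).
Proof.
move=> us mphi.
(* [a i] is the value of [phi i] at the negative point and [b i] the increment to its value at
   [th i]. *)
pose B i := [set th i]; pose a i := phi i (- (th i)^-1).
pose b i := phi i (th i) - a i.
have mB i : measurable (B i) by exact: measurable_set1.
have := @expectation_prod_affine B mB a b s [::] us.
under eq_Rintegral do rewrite big_nil mul1r.
rewrite big_nil mul1r => E.
transitivity (\prod_(i <- s) (a i + b i * fine (P (Z i @^-1` B i)))); last first.
  by apply: eq_bigr => i _; rewrite (noise_pos hZ) /= /b; rewrite /a; ring.
rewrite -E; congr fine; apply: ae_eq_integral => //.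
- apply/measurable_EFinP; apply: measurable_prod => i _.
  exact: measurableT_comp.
- apply/measurable_EFinP; apply: measurable_prod => i _.
  apply: measurable_funD => //; apply: measurable_funM => //.
  by apply: measurable_indic; exact: measurable_noise.
apply: filterS noise_two_values => w Zw _ /=; congr EFin; apply: eq_bigr => i _.
rewrite indicE; case: (Zw i) => Zi.
  by rewrite mem_set// Zi mulr1 /b addrC subrK.
rewrite memNset ?mulr0 ?addr0 ?Zi// /B /preimage /= => E'.
have := theta_gt0 i; rewrite -E' Zi oppr_gt0 invr_lt0 ltNge ltW//.
exact: theta_gt0.
Qed.

End noise.

(** * Moments of the noise and orthonormality of the canonical basis *)

Section canonical_basis.
Context d (Omega : measurableType d) (R : realType) (P : probability Omega R).
Context (p : nat -> R) (Z : nat -> {RV P >-> R}) (hZ : bernoulli_noise p Z).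
Local Notation th := (theta p).

(** Exponents 0 and 1 allow products over different sets to be written over a common index set and
    multiplied factor by factor. *)
Lemma Zprod_sub (s U : {fset nat}) w : (s `<=` U)%fset ->
  Zprod Z s w = \prod_(i <- U) Z i w ^+ (i \in s).
Proof.
move=> /fsubsetP sU; rewrite /Zprod.
rewrite [RHS](eq_bigr (fun i => if i \in s then Z i w else 1)); last first.
  by move=> i _; case: (i \in s).
rewrite -[RHS]big_mkcond -[RHS]big_filter /=; apply: perm_big; apply: uniq_perm => [||i].
- exact: fset_uniq.
- exact/filter_uniq/fset_uniq.
- by rewrite mem_filter; case: (boolP (i \in s)) => //= /sU ->.
Qed.


Lemma noise_mean n : p n * th n + (1 - p n) * - (th n)^-1 = 0.
Proof.
have /andP[p0 p1] := noise_prob hZ n; have t0 := theta_gt0 hZ n.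
have t2 : th n ^+ 2 = (1 - p n) / p n.
  by rewrite sqr_sqrtr// divr_ge0// ?subr_ge0 ltW.
(* Once [1 - p n] is eliminated, the mean is a rational identity in [p n] and [th n], free of square
   roots. *)
have -> : 1 - p n = p n * th n ^+ 2 by rewrite t2; field; rewrite gt_eqF.
by field; rewrite gt_eqF.
Qed.

Lemma noise_second_moment n :
  p n * th n ^+ 2 + (1 - p n) * (- (th n)^-1) ^+ 2 = 1.
Proof.
have /andP[p0 p1] := noise_prob hZ n.
have t2 : th n ^+ 2 = (1 - p n) / p n.
  by rewrite sqr_sqrtr// divr_ge0// ?subr_ge0 ltW.
rewrite sqrrN exprVn t2; field.
by rewrite gt_eqF//= subr_eq0 gt_eqF.
Qed.

(** The expectation factors over the union of [s] and [t]: an index in both contributes the second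
    moment 1, an index in exactly one contributes the mean 0. *)
Lemma Rintegral_Zprod_mul (s t : {fset nat}) :
  (\int[P]_w (Zprod Z s w * Zprod Z t w))%R = (s == t)%:R.
Proof.
pose U := (s `|` t)%fset.
pose phi (i : nat) (x : R) := x ^+ ((i \in s) + (i \in t)).
transitivity (\int[P]_w \prod_(i <- U) phi i (Z i w))%R.
  apply: eq_Rintegral => w _.
  rewrite (@Zprod_sub s U) ?fsubsetUl// (@Zprod_sub t U) ?fsubsetUr//.
  by rewrite -big_split; apply: eq_bigr => i _; rewrite /phi exprD.
rewrite (expectation_prod_noise hZ) ?fset_uniq//; last first.
  by move=> i; exact: exprn_measurable.
have [st|st] := eqVneq s t.
  rewrite big_seq big1// => i; rewrite /U st fsetUid /phi st => ->.
  exact: noise_second_moment.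
have [i iU ist] : exists2 i, i \in U & (i \in s) != (i \in t).
  apply: contrapT => H; move/eqP: st; apply; apply/fsetP => i.
  have [iU|] := boolP (i \in U).
    by apply/eqP; apply: contrapT => /negP ?; apply: H; exists i.
  by rewrite /U in_fsetU negb_or => /andP[/negbTE-> /negbTE->].
apply/eqP; rewrite prodf_seq_eq0; apply/hasP; exists i; first by [].
rewrite /phi (_ : ((i \in s) + (i \in t))%N = 1%N) ?expr1 ?noise_mean ?eqxx//.
by move: ist; case: (i \in s); case: (i \in t).
Qed.

Lemma inner_Zbasis (s t : {fset nat}) :
  inner (Zbasis hZ s) (Zbasis hZ t) = (s == t)%:R.
Proof.
rewrite inner_pi (_ : _%:R = ((s == t)%:R : R)%:C%C); last by rewrite rmorph_nat.
rewrite -Rintegral_Zprod_mul; apply/eqP; rewrite eq_complex /=.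
apply/andP; split; apply/eqP.
  by apply: eq_Rintegral => w _ /=; ring.
transitivity (\int[P]_w (0 : R))%R; last by rewrite Rintegral_cst// mul0r.
by apply: eq_Rintegral => w _ /=; ring.
Qed.

(* A function on a two-point set is affine. *)
Lemma indic_noise_affine (B : nat -> set R) : exists a b : nat -> R,
  {ae P, forall w i, \1_(Z i @^-1` B i) w = a i + b i * Z i w}.
Proof.
(* The slope of the chord through the two values of [Z i], which lie at distance
   [th i + (th i)^-1]. *)
pose c i := (\1_(B i) (th i) - \1_(B i) (- (th i)^-1)) / (th i + (th i)^-1) : R.
exists (fun i => \1_(B i) (th i) - c i * th i), c.
apply: filterS (noise_two_values hZ) => w Zw i.
have t0 := theta_gt0 hZ i.
have -> : \1_(Z i @^-1` B i) w = \1_(B i) (Z i w) :> R by rewrite !indicE.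
case: (Zw i) => ->; first by ring.
rewrite [RHS](_ : _ = \1_(B i) (th i) - c i * (th i + (th i)^-1)); last by ring.
have D0 : th i + (th i)^-1 != 0 by rewrite gt_eqF// addr_gt0 ?invr_gt0.
by rewrite /c (divfK D0) subKr.
Qed.

(** * Totality of the canonical basis *)

Section totality.
Context (g : Omega -> R) (gL2 : g \in Lfun P 2%:E).
Context (orthog : forall s, (\int[P]_w (Zprod Z s w * g w))%R = 0).

Let Zg_integrable s : P.-integrable setT (EFin \o (fun w => Zprod Z s w * g w)).
Proof.
have /andP[ZL2 _] := Zprod_L2 hZ s.
exact/Lfun1_integrable/(Lfun2_mul_Lfun1 ZL2 gL2).
Qed.

Let g_integrable : P.-integrable setT (EFin \o g).
Proof.
apply: (eq_integrable measurableT _ _ _ (Zg_integrable fset0)) => w _ /=.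
by rewrite /Zprod big_seq_fset0 mul1r.
Qed.

(** Replacing one indicator by its affine form in [Z i] either drops [i] or moves it from [t] into
    [s]; induction ends at the hypothesis [orthog]. Disjointness of [t] and [s] ensures that no
    square of a [Z i] appears. *)
Lemma Rintegral_cylinder_Zprod_eq0 (B : nat -> set R) (t : seq nat)
    (s : {fset nat}) :
  (forall i, measurable (B i)) -> uniq t -> {in t, forall i, i \notin s} ->
  (\int[P]_w ((\prod_(i <- t) \1_(Z i @^-1` B i) w) * (Zprod Z s w * g w)))%R = 0.
Proof.
move=> mB; have [a [b ab]] := indic_noise_affine B.
have I r u : P.-integrable setT (EFin \o (fun w =>
    (\prod_(i <- r) \1_(Z i @^-1` B i) w) * (Zprod Z u w * g w))).
  apply: (finite_integrable_prod (M := cst 1)) => //.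
    by move=> i; apply: measurable_indic; exact: measurable_noise.
  by move=> i w; rewrite indicE ger0_norm// lern1 leq_b1.
have IZ c r u : P.-integrable setT (EFin \o (fun w =>
    c * ((\prod_(i <- r) \1_(Z i @^-1` B i) w) * (Zprod Z u w * g w)))).
  exact: (integrableZl measurableT c (I r u)).
elim: t s => [|i t IH] s.
  by move=> _ _; under eq_Rintegral do rewrite big_nil mul1r; exact: orthog.
move=> /= /andP[it ut] ts.
have iNs : i \notin s by apply: ts; rewrite mem_head.
transitivity (\int[P]_w
    (a i * ((\prod_(i <- t) \1_(Z i @^-1` B i) w) * (Zprod Z s w * g w)) +
     b i * ((\prod_(i <- t) \1_(Z i @^-1` B i) w) *
       (Zprod Z (i |` s)%fset w * g w))))%R.
  have ID := integrableD measurableT (IZ (a i) t s) (IZ (b i) t (i |` s)%fset).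
  congr fine; apply: ae_eq_integral => //.
  - exact: measurable_int (I (i :: t) s).
  - exact: measurable_int ID.
  apply: filterS ab => w abw _ /=; congr EFin.
  by rewrite big_cons {1}abw /Zprod big_fsetU1//=; ring.
rewrite (RintegralD measurableT (IZ _ _ _) (IZ _ _ _)).
rewrite !(RintegralZl _ measurableT)// !IH// ?mulr0 ?addr0//.
  move=> j jt; rewrite in_fset1U negb_or; apply/andP; split.
    by apply: contraNneq it => <-.
  by apply: ts; rewrite inE jt orbT.
by move=> j jt; apply: ts; rewrite inE jt orbT.
Qed.

(** The bound [N] leaves finitely many constrained coordinates, so the indicator is a finite
    product; indexing by all [i] makes intersections coordinatewise. *)
Let cylinders : set_system Omega := [set C | exists (N : nat) (B : nat -> set R),
  [/\ forall i, measurable (B i), forall i, (N <= i)%N -> B i = setT &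
      C = \bigcap_i (Z i @^-1` B i)]].

Let setI_closed_cylinders : setI_closed cylinders.
Proof.
move=> _ _ [N [B [mB BT ->]]] [N' [B' [mB' BT' ->]]].
exists (maxn N N'), (fun i => B i `&` B' i); split.
- by move=> i; exact: measurableI.
- by move=> i; rewrite geq_max => /andP[/BT -> /BT' ->]; rewrite setIT.
- by rewrite -bigcapI.
Qed.

Let measurable_cylinders : @measurable _ Omega = <<s cylinders >>.
Proof.
apply/seteqP; split; last first.
  apply: smallest_sub; first exact: sigma_algebra_measurable.
  move=> _ [N [B [mB _ ->]]]; apply: bigcap_measurableType => i _.
  exact: measurable_noise.
rewrite (noise_gen hZ); apply: smallest_sub; first exact: smallest_sigma_algebra.
move=> C [n _ [B mB <-]]; apply: sub_gen_smallest.
(* A generator is a cylinder that constrains coordinate [n] alone, hence the bound [n.+1]. *)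
rewrite setTI; exists n.+1, (fun i => if i == n then B else setT); split.
- by move=> i; case: ifP.
- by move=> i; case: ltngtP.
- apply/seteqP; split => [w Bw i _|w /(_ n I)]; last by rewrite eqxx.
  by case: eqP => // ->.
Qed.

(** Dynkin's theorem: the measurable sets over which [g] integrates to zero include the pi-system of
    cylinders and are stable under complements and countable disjoint unions. *)
Let integral_measurable_eq0 (A : set Omega) : measurable A ->
  (\int[P]_(w in A) (g w)%:E = 0)%E.
Proof.
have iA (D : set Omega) : measurable D -> P.-integrable D (EFin \o g).
  by move=> mD; exact: integrableS g_integrable.
have cyl0 (C : set Omega) : cylinders C -> (\int[P]_(w in C) (g w)%:E = 0)%E.
  move=> [N [B [mB BT ->]]].
  have mC : measurable (\bigcap_i (Z i @^-1` B i)).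
    by apply: bigcap_measurableType => i _; exact: measurable_noise.
  rewrite -[LHS](fineK (integrable_fin_num mC (iA _ mC))); congr EFin.
  rewrite -/(Rintegral _ _ _) -[X in Rintegral _ X _]setTI Rintegral_mkcondr.
  (* Coordinates from [N] on are unconstrained, so the indicators below [N] suffice; the empty set
     makes [Zprod] equal to 1. *)
  rewrite -[RHS](@Rintegral_cylinder_Zprod_eq0 B (iota 0 N) fset0 mB (iota_uniq _ _)) //.
  apply: eq_Rintegral => w _.
  rewrite prod_indic_cylinder /Zprod big_seq_fset0 mul1r.
  rewrite (_ : \bigcap_(i in [set` iota 0 N]) _ = \bigcap_i (Z i @^-1` B i)).
    by rewrite patchE indicE; case: ifPn => _; rewrite ?mul1r ?mul0r.
  apply/seteqP; split => x Bx i //= _; last exact: Bx.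
  have [iN|Ni] := ltnP i N; first by apply: Bx; rewrite /= mem_iota.
  by rewrite BT.
move=> mA; move: (mA); rewrite measurable_cylinders; move: A {mA}.
(* The whole space is the unconstrained cylinder; its zero integral yields stability under
   complements. *)
have gT : (\int[P]_(w in setT) (g w)%:E = 0)%E.
  apply: cyl0; exists 0%N, (fun=> setT); split => //.
  by apply/seteqP; split.
apply: (dynkin_induction measurable_cylinders) => //.
- move=> A mA A0; have mAc := measurableC mA.
  have : (\int[P]_(w in A `|` ~` A) (g w)%:E = 0)%E by rewrite setUv.
  rewrite integral_setU//=; first by rewrite A0 add0e.
  + by rewrite setUv; exact: measurable_int g_integrable.
  + by apply/disj_setPS => w [].
- move=> F mF tF F0; rewrite integral_bigcup//; first exact: eseries0.
  by apply: iA; exact: bigcup_measurable.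
Qed.

Lemma Zprod_total : {ae P, forall w, g w = 0}.
Proof.
have := @integral_ae_eq _ _ _ P setT measurableT (cst 0%E) _ g_integrable
  (measurable_cst _).
move=> /(_ _)/filterS; apply; last first.
  by move=> E _ mE; rewrite integral0; exact: integral_measurable_eq0.
by move=> w /(_ I) [].
Qed.

End totality.

(** The basis functions are real, so orthogonality splits into the real and imaginary parts of
    [x]. *)
Lemma Zbasis_total (x : L2 P) : (forall s, inner (Zbasis hZ s) x = 0) -> x = 0.
Proof.
have [f ->] := L2_piP x => f0; have /andP[Rf If] := valP f.
rewrite -L2_pi0; apply/eqP/L2_eqP.
have H s : inner (Zbasis hZ s) (\pi_(L2 P) f) = 0 := f0 s.
have R0 : {ae P, forall w, complex.Re (f w) = 0}.
  apply: (Zprod_total Rf) => s; have := H s; rewrite inner_pi => -[<- _].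
  by apply: eq_Rintegral => w _ /=; case: (f w) => ? ? /=; ring.
have I0 : {ae P, forall w, complex.Im (f w) = 0}.
  apply: (Zprod_total If) => s; have := H s; rewrite inner_pi => -[_ <-].
  by apply: eq_Rintegral => w _ /=; case: (f w) => ? ? /=; ring.
apply: filterS2 R0 I0 => w; case: (f w) => a b /= -> ->.
by [].
Qed.

Lemma Zbasis_ext (x y : L2 P) :
  (forall s, inner (Zbasis hZ s) x = inner (Zbasis hZ s) y) -> x = y.
Proof.
move=> xy; apply/eqP; rewrite -subr_eq0; apply/eqP/Zbasis_total => s.
by rewrite innerBr xy subrr.
Qed.

End canonical_basis.

(** * Annihilation and creation operators: commutation and continuity *)

Section annihilation_creation.
Context d (Omega : measurableType d) (R : realType) (P : probability Omega R).
Context (p : nat -> R) (Z : nat -> {RV P >-> R}) (hZ : bernoulli_noise p Z).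
Context (del delA : nat -> {linear L2 P -> L2 P}).
Context (hdel : forall k, annihilation hZ k (del k)).
Context (hdelA : forall k, is_adjoint (del k) (delA k)).

Let delZ k s : del k (Zbasis hZ s) = (k \in s)%:R *: Zbasis hZ (s `\ k)%fset.
Proof. by have [_ ->] := hdel k. Qed.

Let inner_delA k x y : inner x (delA k y) = inner (del k x) y.
Proof. exact: inner_adjr (hdelA k) x y. Qed.

(** [delA k] is known only as an adjoint, so its value is found by testing against the basis: for
    [r] containing [k], removing [k] from [r] and from [s] gives equal sets only if [r = s]. *)
Lemma creation_Zbasis k s : k \in s ->
  delA k (Zbasis hZ (s `\ k)%fset) = Zbasis hZ s.
Proof.
move=> ks; apply: (Zbasis_ext (hZ := hZ)) => r; rewrite inner_delA delZ.
have [kr|kr] := boolP (k \in r).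
  rewrite scale1r !inner_Zbasis; congr (_%:R); congr nat_of_bool.
  by apply/eqP/eqP => [rs|->//]; rewrite -(fsetD1K kr) rs fsetD1K.
rewrite scale0r inner0l inner_Zbasis.
have [rs|//] := eqVneq r s.
by move: kr; rewrite rs ks.
Qed.

Lemma creation_annihilation_Zbasis k s :
  delA k (del k (Zbasis hZ s)) = (k \in s)%:R *: Zbasis hZ s.
Proof.
rewrite delZ linearZ /=; case: (boolP (k \in s)) => ks; last by rewrite !scale0r.
by rewrite creation_Zbasis.
Qed.

(** On the side of [Zbasis hZ s], the composite of [del k] and [delA k] acts by the eigenvalue 1 or
    0 according to whether [k] is in the index set. Removing [n] from [s] alters this eigenvalue
    only for [k = n], which the last term compensates. *)
Lemma creation_annihilation_creation k n x :
  delA k (del k (delA n x)) =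
  delA n (delA k (del k x)) + (k == n)%:R *: delA n x.
Proof.
apply: (Zbasis_ext (hZ := hZ)) => s.
rewrite innerDr innerZr !inner_delA -!hdelA !inner_delA.
rewrite creation_annihilation_Zbasis linearZ /= delZ.
have DZ (a : R[i]) y : delA k (del k (a *: y)) = a *: delA k (del k y).
  by rewrite linearZ /= linearZ.
rewrite DZ creation_annihilation_Zbasis !inE.
case: eqVneq => [->|_] /=; case: (n \in s);
  by rewrite ?scale0r ?scaler0 ?scale1r ?inner0l ?mul0r ?mul1r ?addr0 ?add0r.
Qed.

(** The squared norm of [delA k x] is the inner product of [x] with [del k (delA k x)];
    Cauchy-Schwarz bounds it by [|M|] times the norms of [x] and [delA k x], and one factor
    cancels. *)
Lemma creation_bounded k : bounded_op (delA k).
Proof.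
have [[M bM] _] := hdel k.
pose nrm (y : L2 P) : R := Num.sqrt (complex.Re (inner y y)).
have nrm0 y : 0 <= nrm y by exact: sqrtr_ge0.
(* The bound [M] comes without a sign condition, hence the absolute value. *)
have bN y : nrm (del k y) <= `|M| * nrm y.
  have := bM y; rewrite !normL2E -rmorphM lecR => /le_trans; apply.
  by apply: ler_wpM2r; [exact: nrm0|exact: ler_norm].
exists `|M| => x; rewrite !normL2E -rmorphM lecR -/(nrm _) -/(nrm x).
have [->|N0] := eqVneq (nrm (delA k x)) 0; first by rewrite mulr_ge0.
have Npos : 0 < nrm (delA k x) by rewrite lt_def N0 nrm0.
rewrite -(ler_pM2r Npos) -expr2 sqr_sqrtr ?Re_inner_ge0// hdelA.
apply: le_trans (Re_inner_le _ _) _.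
by rewrite [leRHS]mulrAC mulrC; apply: ler_wpM2r; [exact: nrm0|exact: bN].
Qed.

Lemma creation_continuous k : continuous (delA k).
Proof.
apply/linear_bounded_continuous/linear_boundedP.
have [M bM] := creation_bounded k.
exists `|M|%:C%C; split; first by rewrite ger0_real ?ler0c.
move=> r Mr x; apply: le_trans (bM x) _; rewrite ler_wpM2r//.
by apply: le_trans (ltW Mr); rewrite lecR ler_norm.
Qed.

End annihilation_creation.

(** * Partial sums of the number operator and their limits *)

Section number_operator.
Context d (Omega : measurableType d) (R : realType) (P : probability Omega R).
Context (p : nat -> R) (Z : nat -> {RV P >-> R}) (hZ : bernoulli_noise p Z).
Context (del delA : nat -> {linear L2 P -> L2 P}) (u : nat -> R).
Context (hdel : forall k, annihilation hZ k (del k)).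
Context (hdelA : forall k, is_adjoint (del k) (delA k)).

Lemma number_series_linear a x y :
  number_series u del delA (a *: x + y) =
  (fun m => a *: number_series u del delA x m + number_series u del delA y m).
Proof.
apply/funext => m; rewrite /number_series !seriesEnat /= scaler_sumr -big_split.
apply: eq_bigr => k _ /=.
by rewrite !(linearP (del k)) (linearP (delA k)) scalerDr scalerA mulrC -scalerA.
Qed.

(** Summing the commutation relation over [k < m] picks up the correction exactly when the index [n]
    occurs, that is, when [n < m]. *)
Lemma number_series_creation n x :
  number_series u del delA (delA n x) =
  (fun m => delA n (number_series u del delA x m) +
            (if (n < m)%N then (u n)%:C%C *: delA n x else 0)).
Proof.
apply/funext => m; rewrite /number_series !seriesEnat /= linear_sum /=.
rewrite (eq_bigr (fun k => delA n ((u k)%:C%C *: delA k (del k x)) +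
    (if k == n then (u n)%:C%C *: delA n x else 0))); last first.
  move=> k _; rewrite (creation_annihilation_creation hdel hdelA) scalerDr [in RHS]linearZ /=.
  by case: eqP => [->|_]; rewrite ?scale1r ?scale0r ?scaler0.
rewrite big_split; congr (_ + _).
by rewrite -big_mkcond /= big_nat1_eq.
Qed.

(** This one limit yields both the invariance of the domain and the operator identity. *)
Lemma number_series_creation_cvg n x l :
  number_series u del delA x @ \oo --> l ->
  number_series u del delA (delA n x) @ \oo -->
    delA n l + (u n)%:C%C *: delA n x.
Proof.
move=> xl; rewrite number_series_creation; apply: cvgD.
  apply: (@cvg_comp _ _ _ _ (delA n) _ (nbhs l)) => //.
  exact: (creation_continuous hdel hdelA).
apply: cvg_near_cst; exists n.+1 => // m /= nm.
by rewrite nm.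
Qed.

End number_operator.

Theorem theorem4p8 (R : realType) (d : measure_display) (Omega : measurableType d)
  (P : probability Omega R) (p : nat -> R) (Z : nat -> {RV P >-> R})
  (hZ : bernoulli_noise p Z)
  (del delA : nat -> {linear L2 P -> L2 P})
  (hdel : forall k, annihilation hZ k (del k))
  (hdelA : forall k, is_adjoint (del k) (delA k))
  (u : nat -> R) (hu_bounded : bounded_fun (u : nat -> R^o))
  (hu_ge0 : forall k, 0 <= u k) :
  forall n : nat,
    invariant_subspace (delA n) (number_dom u del delA) /\
    (forall xi : L2 P, number_dom u del delA xi ->
       number_op u del delA (delA n xi) =
         delA n (number_op u del delA xi) + (u n)%:C%C *: delA n xi).
Proof.
move=> n; split; last first.
  (* [number_op] is a chosen limit, so the identity rests on uniqueness of limits. *)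
  move=> x xD; apply/cvg_lim; first exact: norm_hausdorff.
  exact: (number_series_creation_cvg hdel hdelA).
split.
- apply/cvg_ex; exists 0; rewrite (_ : number_series _ _ _ _ = cst 0).
    exact: cvg_cst.
  apply/funext => m; rewrite /number_series seriesEnat /= big1// => k _.
  by rewrite !linear0.
- move=> a x y xD yD; rewrite /number_dom /= number_series_linear.
  by apply: is_cvgD => //; exact: is_cvgZl_tmp.
- move=> _ [x xD <-]; apply/cvg_ex; eexists.
  exact: (number_series_creation_cvg hdel hdelA xD).
Qed.
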